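(* Let $N$ be a positive integer and let $\mathbf K_1\in\mathbb C^{N\times N}$ be an invertible constant matrix such that $\mathbf K_1$ and $-(\mathbf K_1^* )^{-1}$ have no eigenvalue in common. Let $\xi_n,\eta_n$ ($n=1,2,\dots$) be real independent variables, $z_n=\xi_n+\mathrm i\eta_n$, $\bar z_n=z_n^*=\xi_n-\mathrm i\eta_n$. Let $\mathbf r_1,\mathbf s_1\in\mathbb C^N$ (column vectors) and $\mathbf M_1\in\mathbb C^{N\times N}$ be functions of these variables satisfying, for $n=1,2,\dots$, $$\mathbf K_1\mathbf M_1+\mathbf M_1(\mathbf K_1^* )^{-1}=-\mathbf r_1\mathbf s_1^\dagger(\mathbf K_1^* )^{-1},$$ $$\partial_{\xi_n}\mathbf r_1=(\mathbf K_1^n+(-1)^{n+1}\mathbf K_1^{-n})\mathbf r_1,\quad \partial_{\eta_n}\mathbf r_1=\mathrm i(\mathbf K_1^n-(-1)^{n+1}\mathbf K_1^{-n})\mathbf r_1,$$ $$\partial_{\xi_n}\mathbf s_1=((\mathbf K_1^T)^n+(-1)^{n+1}(\mathbf K_1^T)^{-n})\mathbf s_1,\quad \partial_{\eta_n}\mathbf s_1=\mathrm i((\mathbf K_1^T)^n-(-1)^{n+1}(\mathbf K_1^T)^{-n})\mathbf s_1.$$ On the domain where $\mathbf I_N-\mathbf M_1^*\mathbf M_1$ is invertible, define $$s_1^{(-1,0)}=\mathbf s_1^\dagger(\mathbf K_1^* )^{-1}(\mathbf I_N-\mathbf M_1^*\mathbf M_1)^{-1}\mathbf M_1^*\mathbf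 K_1^{-1}\mathbf r_1,\quad s_3^{(-1,0)}=\mathbf s_1^T(\mathbf I_N-\mathbf M_1\mathbf M_1^* )^{-1}\mathbf K_1^{-1}\mathbf r_1,$$ $$s_4^{(-1,0)}=\mathbf s_1^T\mathbf M_1(\mathbf I_N-\mathbf M_1^*\mathbf M_1)^{-1}\mathbf r_1^*,$$ and $$\mathbf v=\begin{pmatrix}1-s_1^{(-1,0)}&-(s_3^{(-1,0)})^*\\ -s_3^{(-1,0)}&1-s_4^{(-1,0)}\end{pmatrix}.$$ Then $\mathbf v$ solves the self-dual Yang--Mills equation $$(\mathbf v_{z_{n+1}}\mathbf v^{-1})_{\bar z_{n+1}}+(\mathbf v_{\bar z_n}\mathbf v^{-1})_{z_n}=0,\qquad n=1,2,\dots,$$ and $\mathbf v=\mathbf v^\dagger$, $\det\mathbf v=1$; consequently at each point $\mathbf v$ is either positive definite or negative definite.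
   Context: $^*$ denotes entrywise complex conjugation, $^T$ transpose, $^\dagger$ conjugate transpose, $\mathbf I_N$ the $N\times N$ identity. Derivatives with respect to $z_n,\bar z_n$ are the Wirtinger-type derivatives $\partial_{z_n}=\tfrac12(\partial_{\xi_n}-\mathrm i\partial_{\eta_n})$, $\partial_{\bar z_n}=\tfrac12(\partial_{\xi_n}+\mathrm i\partial_{\eta_n})$ (so that $\partial_{\xi_n}=\partial_{z_n}+\partial_{\bar z_n}$, $\partial_{\eta_n}=\mathrm i(\partial_{z_n}-\partial_{\bar z_n})$); subscripts denote partial derivatives. *)

(* Defs.v *)
From HB Require Import structures.
From mathcomp Require Import all_boot all_order all_algebra.
From mathcomp Require Import all_classical all_reals.
From mathcomp Require Import topology normedtype derive.
From mathcomp Require Import complex.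
Set Implicit Arguments. Unset Strict Implicit. Unset Printing Implicit Defensive.
Import Order.TTheory GRing.Theory Num.Theory.
Import numFieldNormedType.Exports.
Local Open Scope ring_scope.

(* MathComp + MathComp-Analysis, real variables in an abstract R : realType,
   complex numbers R[i] from mathcomp-real-closed. *)

Section Defs.
Variable R : realType.
Local Notation C := (R[i]).

(* entrywise complex conjugate, conjugate transpose *)
Definition mconj m n (A : 'M[C]_(m, n)) : 'M[C]_(m, n) := map_mx (fun z => z^*) A.
Definition adjmx m n (A : 'M[C]_(m, n)) : 'M[C]_(n, m) := (mconj A)^T.

(* points: xi n = ξ_n, eta n = η_n (index 0 is an unused dummy coordinate) *)
Definition upd (x : nat -> R) (k : nat) (t : R) : nat -> R :=
  fun j => if j == k then t else x j.

(* derivative of a complex-valued function of one real variable, via real and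
   imaginary parts *)
Definition derivableC (g : R -> C) (t : R) : Prop :=
  derivable (fun u : R => complex.Re (g u)) t 1 /\ derivable (fun u : R => complex.Im (g u)) t 1.
Definition derivC (g : R -> C) (t : R) : C :=
  Complex (derive1 (fun u : R => complex.Re (g u)) t) (derive1 (fun u : R => complex.Im (g u)) t).

(* a matrix-valued function of the variables (ξ, η) *)
Definition mfun m n := (nat -> R) -> (nat -> R) -> 'M[C]_(m, n).

(* partial derivatives ∂_{ξ_k}, ∂_{η_k} of matrix-valued functions, entrywise *)
Definition derivable_xi m n (k : nat) (F : mfun m n) xi eta : Prop :=
  forall i j, derivableC (fun t => F (upd xi k t) eta i j) (xi k).
Definition derivable_eta m n (k : nat) (F : mfun m n) xi eta : Prop :=
  forall i j, derivableC (fun t => F xi (upd eta k t) i j) (eta k).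
Definition d_xi m n (k : nat) (F : mfun m n) : mfun m n := fun xi eta =>
  \matrix_(i, j) derivC (fun t => F (upd xi k t) eta i j) (xi k).
Definition d_eta m n (k : nat) (F : mfun m n) : mfun m n := fun xi eta =>
  \matrix_(i, j) derivC (fun t => F xi (upd eta k t) i j) (eta k).

(* Wirtinger derivatives ∂_{z_k} = (∂_ξ - i ∂_η)/2, ∂_{zbar_k} = (∂_ξ + i ∂_η)/2 *)
Definition d_z m n k (F : mfun m n) : mfun m n := fun xi eta =>
  2^-1 *: (d_xi k F xi eta - 'i%C *: d_eta k F xi eta).
Definition d_zbar m n k (F : mfun m n) : mfun m n := fun xi eta =>
  2^-1 *: (d_xi k F xi eta + 'i%C *: d_eta k F xi eta).

Definition mx2 (a b c d : C) : 'M[C]_2 :=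
  \matrix_(i < 2, j < 2)
    if (i == 0 :> nat) then (if (j == 0 :> nat) then a else b)
    else (if (j == 0 :> nat) then c else d).

Definition posdef n (A : 'M[C]_n) : Prop :=
  forall x : 'cV[C]_n, x != 0 -> 0 < (adjmx x *m A *m x) 0 0.
Definition negdef n (A : 'M[C]_n) : Prop :=
  forall x : 'cV[C]_n, x != 0 -> (adjmx x *m A *m x) 0 0 < 0.

(* the matrix v of the theorem, built from K1, r1, s1, M1 *)
Definition vmat N (K : 'M[C]_N) (r s : 'cV[C]_N) (M : 'M[C]_N) : 'M[C]_2 :=
  let Ks := mconj K in
  let s1 := (adjmx s *m invmx Ks *m invmx (1%:M - mconj M *m M)
              *m mconj M *m invmx K *m r) 0 0 in
  let s3 := (s^T *m invmx (1%:M - M *m mconj M) *m invmx K *m r) 0 0 in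
  let s4 := (s^T *m M *m invmx (1%:M - mconj M *m M) *m mconj r) 0 0 in
  mx2 (1 - s1) (- s3^*) (- s3) (1 - s4).

End Defs.

Arguments mconj {R m n}.
Arguments adjmx {R m n}.
Arguments derivable_xi {R m n}.
Arguments derivable_eta {R m n}.
Arguments d_xi {R m n}.
Arguments d_eta {R m n}.
Arguments d_z {R m n}.
Arguments d_zbar {R m n}.
Arguments posdef {R n}.
Arguments negdef {R n}.
Arguments vmat {R N}.
Arguments mx2 {R}.

(* Main.v *)
Require Import Defs.
From HB Require Import structures.
From mathcomp Require Import all_boot all_order all_algebra.
From mathcomp Require Import all_classical all_reals.
From mathcomp Require Import topology normedtype derive.
From mathcomp Require Import complex.
From mathcomp Require Import ring.
Set Implicit Arguments. Unset Strict Implicit. Unset Printing Implicit Defensive.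
Import Order.TTheory GRing.Theory Num.Theory.
Import numFieldNormedType.Exports.
Local Open Scope ring_scope.

(* Write K* for the entrywise conjugate and stack the data into 2N x 2N blocks:
     K = diag(K1, -(K1* )^-1),  M = [[0, M1], [M1*, 0]],  W = (1 + M)^-1,
     r = diag(r1, (K1* )^-1 r1* ),  s = [[0, -s1^+ (K1* )^-1], [s1^T, 0]].
   The Sylvester equation becomes K M - M K = r s, and v = 1 - s W K^-1 r.  From this
   identity alone, det v = 1 and v^-1 = 1 + s K^-1 W r; comparing v^-1 with the adjugate
   of v gives v = v^+.
   A real variable along which r1' = P r1 and s1' = P^T s1, with P commuting with K1,
   acts by B = diag(P, P* ): r' = B r, s' = s B and, by uniqueness for the Sylvester
   equation, M' = B M + M B.  Hence v' v^-1 = -2 s W B K^-1 W r, while the derivative of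
   s W X W r along B is symmetric in X and B.  For z_n and its conjugate the directions
   are Z_n and Zb_n with Z_(n+1) = K Z_n and K Zb_(n+1) = - Zb_n, so the two terms of the
   Yang-Mills equation are -2 and +2 times the same mixed derivative. *)

(** * Differential calculus for complex-valued and matrix-valued functions of one real variable *)

Section Calculus.
Variable R : realType.
Local Notation C := (R[i]).
Implicit Types (f g : R -> C) (t : R) (d e c : C).

(** A relation bundling differentiability with the value, so that the rules compose without separate
    differentiability side goals. *)
Definition is_derivC f t d : Prop :=
  is_derive t 1 (fun u => complex.Re (f u)) (complex.Re d) /\
  is_derive t 1 (fun u => complex.Im (f u)) (complex.Im d).

Lemma is_derivC_derivable f t d : is_derivC f t d -> derivableC f t.
Proof. by move=> [[? _] [? _]]; split. Qed.

Lemma is_derivC_val f t d : is_derivC f t d -> Defs.derivC f t = d.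
Proof.
by move=> [[_ h1] [_ h2]]; rewrite /Defs.derivC !derive1E h1 h2; case: d {h1 h2}.
Qed.

Lemma derivableCP f t : derivableC f t -> is_derivC f t (Defs.derivC f t).
Proof.
by move=> [h1 h2]; split; rewrite /= derive1E; apply: DeriveDef.
Qed.

Lemma near_eq_is_derivC f g t d :
  (\near t, f t = g t) -> is_derivC f t d -> is_derivC g t d.
Proof.
move=> fg [h1 h2]; split.
- by apply: near_eq_is_derive h1; near=> u; congr complex.Re; near: u.
- by apply: near_eq_is_derive h2; near=> u; congr complex.Im; near: u.
Unshelve. all: by end_near. Qed.

Lemma is_derivC_cst c t : is_derivC (fun=> c) t 0.
Proof. by split; apply: is_derive_cst. Qed.

Lemma ReD (x y : C) : complex.Re (x + y) = complex.Re x + complex.Re y.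
Proof. by case: x y => [a b] [c d]. Qed.

Lemma ImD (x y : C) : complex.Im (x + y) = complex.Im x + complex.Im y.
Proof. by case: x y => [a b] [c d]. Qed.

Lemma ReM (x y : C) : complex.Re (x * y) =
  complex.Re x * complex.Re y - complex.Im x * complex.Im y.
Proof. by case: x y => [a b] [c d]. Qed.

Lemma ImM (x y : C) : complex.Im (x * y) =
  complex.Re x * complex.Im y + complex.Im x * complex.Re y.
Proof. by case: x y => [a b] [c d]. Qed.

Lemma ReV (x : C) : complex.Re x^-1 =
  complex.Re x * (complex.Re x * complex.Re x + complex.Im x * complex.Im x)^-1.
Proof. by case: x => a b; rewrite -!expr2. Qed.

Lemma ImV (x : C) : complex.Im x^-1 =
  - complex.Im x * (complex.Re x * complex.Re x + complex.Im x * complex.Im x)^-1.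
Proof. by case: x => a b; rewrite -!expr2 mulNr. Qed.

Lemma ReJ (x : C) : complex.Re x^* = complex.Re x.
Proof. by case: x. Qed.

Lemma ImJ (x : C) : complex.Im x^* = - complex.Im x.
Proof. by case: x. Qed.

Lemma is_derivCD f g t d e :
  is_derivC f t d -> is_derivC g t e -> is_derivC (fun u => f u + g u) t (d + e).
Proof.
move=> [f1 f2] [g1 g2]; split.
- have -> : (fun u => complex.Re (f u + g u)) =
    (fun u => complex.Re (f u)) + (fun u => complex.Re (g u)).
    by apply/funext=> u /=; rewrite ReD.
  by rewrite ReD; apply: is_deriveD.
- have -> : (fun u => complex.Im (f u + g u)) =
    (fun u => complex.Im (f u)) + (fun u => complex.Im (g u)).
    by apply/funext=> u /=; rewrite ImD.
  by rewrite ImD; apply: is_deriveD.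
Qed.

Lemma is_derivCM f g t d e : is_derivC f t d -> is_derivC g t e ->
  is_derivC (fun u => f u * g u) t (d * g t + f t * e).
Proof.
move=> [f1 f2] [g1 g2]; split.
- have -> : (fun u => complex.Re (f u * g u)) =
    (fun u => complex.Re (f u)) * (fun u => complex.Re (g u)) -
    (fun u => complex.Im (f u)) * (fun u => complex.Im (g u)).
    by apply/funext=> u /=; rewrite ReM.
  apply: is_derive_eq; rewrite ReD !ReM /= /GRing.scale/=; ring.
- have -> : (fun u => complex.Im (f u * g u)) =
    (fun u => complex.Re (f u)) * (fun u => complex.Im (g u)) +
    (fun u => complex.Im (f u)) * (fun u => complex.Re (g u)).
    by apply/funext=> u /=; rewrite ImM.
  apply: is_derive_eq; rewrite ImD !ImM /= /GRing.scale/=; ring.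
Qed.

Lemma is_derivC_conj f t d :
  is_derivC f t d -> is_derivC (fun u => (f u)^*) t d^*.
Proof.
move=> [f1 f2]; split.
- have -> : (fun u => complex.Re (f u)^*) = (fun u => complex.Re (f u)).
    by apply/funext=> u; rewrite ReJ.
  by rewrite ReJ.
- have -> : (fun u => complex.Im (f u)^*) = - (fun u => complex.Im (f u)).
    by apply/funext=> u; rewrite ImJ.
  by rewrite ImJ; apply: is_deriveN.
Qed.

Lemma is_derivC_neq0 f t d : is_derivC f t d -> f t != 0 ->
  \forall u \near t, f u != 0.
Proof.
have cont (h : R -> R) (e : R) : is_derive t 1 h e -> {for t, continuous h}.
  by case=> dh _; apply: differentiable_continuous; exact/derivable1_diffP.
move=> [/cont f1 /cont f2]; rewrite eq_complex negb_and => /orP[h|h].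
- apply: filterS (cvgr_neq0 _ f1 h) => u /=.
  by apply: contra => /eqP ->.
- apply: filterS (cvgr_neq0 _ f2 h) => u /=.
  by apply: contra => /eqP ->.
Qed.

(** The real and imaginary parts of [1 / f] are those of [conj f] over [|f|^2]. Existence suffices:
    the derivative of an inverse matrix is later forced by the product rule. *)
Lemma is_derivCV f t d : is_derivC f t d -> f t != 0 ->
  exists e, is_derivC (fun u => (f u)^-1) t e.
Proof.
move=> [f1 f2] ft0.
pose q := (fun u => complex.Re (f u)) * (fun u => complex.Re (f u)) +
          (fun u => complex.Im (f u)) * (fun u => complex.Im (f u)).
have qt0 : q t != 0.
  apply: contra ft0; rewrite /q /= -!expr2 paddr_eq0 ?sqr_ge0// !sqrf_eq0.
  by rewrite eq_complex.
have dq : derivable q t 1 by apply: ex_derive.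
have dqV : derivable (fun u => (q u)^-1) t 1 by exact: derivableV.
have reE : (fun u => complex.Re (f u)^-1) = (fun u => complex.Re (f u)) * (fun u => (q u)^-1).
  by apply/funext=> u; rewrite ReV.
have imE : (fun u => complex.Im (f u)^-1) = - (fun u => complex.Im (f u)) * (fun u => (q u)^-1).
  by apply/funext=> u; rewrite ImV.
exists (Defs.derivC (fun u => (f u)^-1) t); apply: derivableCP; split.
- by rewrite reE; apply: derivableM.
- by rewrite imE; apply: derivableM; first exact: derivableN.
Qed.

Lemma is_derivC_sum (I : Type) (s : seq I) (P : pred I) (F : I -> R -> C) t
    (d : I -> C) : (forall i, is_derivC (F i) t (d i)) ->
  is_derivC (fun u => \sum_(i <- s | P i) F i u) t (\sum_(i <- s | P i) d i).
Proof.
move=> h; elim: s => [|i s IH].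
  under eq_fun do rewrite big_nil.
  by rewrite big_nil; exact: is_derivC_cst.
under eq_fun do rewrite big_cons.
by rewrite big_cons; case: (P i) => //; exact: is_derivCD.
Qed.

Lemma derivableCM f g t :
  derivableC f t -> derivableC g t -> derivableC (fun u => f u * g u) t.
Proof.
by move=> /derivableCP hf /derivableCP hg; apply: is_derivC_derivable (is_derivCM hf hg).
Qed.

Lemma derivableC_cst c t : derivableC (fun=> c) t.
Proof. exact: is_derivC_derivable (is_derivC_cst c t). Qed.

Lemma derivableC_prod (I : Type) (s : seq I) (P : pred I) (F : I -> R -> C) t :
  (forall i, derivableC (F i) t) ->
  derivableC (fun u => \prod_(i <- s | P i) F i u) t.
Proof.
move=> h; elim: s => [|i s IH].
  by under eq_fun do rewrite big_nil; exact: derivableC_cst.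
under eq_fun do rewrite big_cons.
by case: (P i) => //; exact: derivableCM.
Qed.

Lemma derivableC_det n (F : R -> 'M[C]_n) t :
  (forall i j, derivableC (fun u => F u i j) t) ->
  derivableC (fun u => \det (F u)) t.
Proof.
move=> h; rewrite /determinant; apply: is_derivC_derivable.
apply: is_derivC_sum => s; apply: derivableCP; apply: derivableCM.
  exact: derivableC_cst.
by apply: derivableC_prod => i.
Qed.

Lemma derivableC_cofactor n (F : R -> 'M[C]_n) t k l :
  (forall i j, derivableC (fun u => F u i j) t) ->
  derivableC (fun u => cofactor (F u) k l) t.
Proof.
move=> h; rewrite /cofactor; apply: derivableCM; first exact: derivableC_cst.
apply: derivableC_det => i j.
by under eq_fun do rewrite !mxE; exact: h.
Qed.

Definition is_derivmx m n (F : R -> 'M[C]_(m, n)) t (D : 'M[C]_(m, n)) : Prop :=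
  forall i j, is_derivC (fun u => F u i j) t (D i j).

Lemma is_derivmx_uniq m n (F : R -> 'M[C]_(m, n)) t D E :
  is_derivmx F t D -> is_derivmx F t E -> D = E.
Proof.
move=> hD hE; apply/matrixP => i j.
by rewrite -(is_derivC_val (hD i j)) -(is_derivC_val (hE i j)).
Qed.

Lemma near_eq_is_derivmx m n (F G : R -> 'M[C]_(m, n)) t D :
  (\near t, F t = G t) -> is_derivmx F t D -> is_derivmx G t D.
Proof.
move=> FG h i j; apply: near_eq_is_derivC (h i j).
by apply: filterS FG => u ->.
Qed.

Lemma is_derivmx_cst m n (A : 'M[C]_(m, n)) t : is_derivmx (fun=> A) t 0.
Proof. by move=> i j; rewrite mxE; exact: is_derivC_cst. Qed.

Lemma is_derivmxD m n (F G : R -> 'M[C]_(m, n)) t D E :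
  is_derivmx F t D -> is_derivmx G t E -> is_derivmx (fun u => F u + G u) t (D + E).
Proof.
move=> hF hG i j; rewrite mxE; under eq_fun do rewrite mxE.
exact: is_derivCD.
Qed.

Lemma is_derivmxM m n p (F : R -> 'M[C]_(m, n)) (G : R -> 'M[C]_(n, p)) t D E :
  is_derivmx F t D -> is_derivmx G t E ->
  is_derivmx (fun u => F u *m G u) t (D *m G t + F t *m E).
Proof.
move=> hF hG i j; rewrite !mxE -big_split; under eq_fun do rewrite mxE.
by apply: is_derivC_sum => k; exact: is_derivCM.
Qed.

Lemma is_derivmxMl m n p (A : 'M[C]_(m, n)) (G : R -> 'M[C]_(n, p)) t E :
  is_derivmx G t E -> is_derivmx (fun u => A *m G u) t (A *m E).
Proof.
move=> hG; have := is_derivmxM (is_derivmx_cst A t) hG.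
by rewrite mul0mx add0r.
Qed.

Lemma is_derivmxMr m n p (F : R -> 'M[C]_(m, n)) (A : 'M[C]_(n, p)) t D :
  is_derivmx F t D -> is_derivmx (fun u => F u *m A) t (D *m A).
Proof.
move=> hF; have := is_derivmxM hF (is_derivmx_cst A t).
by rewrite mulmx0 addr0.
Qed.

Lemma is_derivmx_conj m n (F : R -> 'M[C]_(m, n)) t D :
  is_derivmx F t D -> is_derivmx (fun u => mconj (F u)) t (mconj D).
Proof.
move=> hF i j; rewrite mxE; under eq_fun do rewrite mxE.
exact: is_derivC_conj.
Qed.

Lemma is_derivmx_tr m n (F : R -> 'M[C]_(m, n)) t D :
  is_derivmx F t D -> is_derivmx (fun u => (F u)^T) t D^T.
Proof. by move=> hF i j; rewrite mxE; under eq_fun do rewrite mxE. Qed.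

Lemma is_derivmx_block m1 m2 n1 n2 (F1 : R -> 'M[C]_(m1, n1))
    (F2 : R -> 'M[C]_(m1, n2)) (F3 : R -> 'M[C]_(m2, n1))
    (F4 : R -> 'M[C]_(m2, n2)) t D1 D2 D3 D4 :
  is_derivmx F1 t D1 -> is_derivmx F2 t D2 ->
  is_derivmx F3 t D3 -> is_derivmx F4 t D4 ->
  is_derivmx (fun u => block_mx (F1 u) (F2 u) (F3 u) (F4 u)) t
    (block_mx D1 D2 D3 D4).
Proof.
move=> h1 h2 h3 h4 i j.
by case: (split_ordP i) => k ->; case: (split_ordP j) => l ->;
  rewrite ?(block_mxEul, block_mxEur, block_mxEdl, block_mxEdr);
  under eq_fun do rewrite ?(block_mxEul, block_mxEur, block_mxEdl, block_mxEdr).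
Qed.

Lemma is_derivmx_unit n (F : R -> 'M[C]_n) t D :
  is_derivmx F t D -> F t \in unitmx -> \forall u \near t, F u \in unitmx.
Proof.
move=> hF; rewrite unitmxE unitfE => h.
have /derivableCP dd : derivableC (fun u => \det (F u)) t.
  by apply: derivableC_det => i j; exact: is_derivC_derivable (hF i j).
by apply: filterS (is_derivC_neq0 dd h) => u; rewrite unitmxE unitfE.
Qed.

(** Cofactors over the determinant give differentiability; differentiating [F F^-1 = 1] then gives
    the value. *)
Lemma is_derivmxV n (F : R -> 'M[C]_n) t D :
  is_derivmx F t D -> F t \in unitmx ->
  is_derivmx (fun u => invmx (F u)) t (- (invmx (F t) *m D *m invmx (F t))).
Proof.
move=> hF Ft; have nu := is_derivmx_unit hF Ft.
have dF i j : derivableC (fun u => F u i j) t by exact: is_derivC_derivable (hF i j).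
have [E hE] : exists E, is_derivmx (fun u => invmx (F u)) t E.
  have [e he] : exists e, is_derivC (fun u => (\det (F u))^-1) t e.
    apply: is_derivCV (derivableCP (derivableC_det dF)) _.
    by rewrite -unitfE -unitmxE.
  exists (\matrix_(i, j) Defs.derivC (fun u => (\det (F u))^-1 * cofactor (F u) j i) t).
  (* [invmx] is given by the adjugate formula only at invertible matrices, so the two functions are
     compared near [t] only. *)
  apply: (@near_eq_is_derivmx _ _ (fun u => (\det (F u))^-1 *: \adj (F u))).
    by apply: filterS nu => u; rewrite /invmx => ->.
  move=> i j; rewrite mxE; under eq_fun do rewrite !mxE.
  apply: derivableCP; apply: derivableCM; first exact: is_derivC_derivable he.
  exact: derivableC_cofactor.
have h1 : is_derivmx (fun u => F u *m invmx (F u)) t 0.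
  apply: near_eq_is_derivmx (is_derivmx_cst 1%:M t).
  by apply: filterS nu => u Fu; rewrite mulmxV.
have /eqP := is_derivmx_uniq (is_derivmxM hF hE) h1.
rewrite addrC addr_eq0 => /eqP/(congr1 (mulmx (invmx (F t)))).
by rewrite mulKmx // => eE; rewrite eE mulmxN mulmxA in hE.
Qed.
End Calculus.

(** * Uniqueness and linear solvability of the Sylvester equation *)

Section Sylvester.
Variable F : closedFieldType.

Lemma eigenvalueN_unitmx n (L : 'M[F]_n) a : ~~ eigenvalue L a ->
  L - a%:M \in unitmx.
Proof. by rewrite /eigenvalue /eigenspace negbK kermx_eq0 row_free_unit. Qed.

Lemma intertwine_horner n (K L X : 'M[F]_n.+1) (p : {poly F}) :
  K *m X = X *m L -> horner_mx K p *m X = X *m horner_mx L p.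
Proof.
move=> KX; elim/poly_ind: p => [|p c IH]; first by rewrite !rmorph0 mul0mx mulmx0.
rewrite !rmorphD !rmorphM /= !horner_mx_X !horner_mx_C mulmxDl mulmxDr.
rewrite -!mulmxE -mulmxA KX mulmxA IH -mulmxA; congr (_ + _).
by rewrite scalar_mxC.
Qed.

(** Let [p] be the characteristic polynomial of [K]. Intertwining gives [p(K) X = X p(L)], where
    [p(K) = 0] by Cayley-Hamilton and [p(L)] is a product of factors [L - a] with [a] an eigenvalue
    of [K], each invertible by disjointness of the spectra. *)
Lemma intertwine_eq0 n (K L X : 'M[F]_n) :
  (forall a, ~~ (eigenvalue K a && eigenvalue L a)) -> K *m X = X *m L -> X = 0.
Proof.
(* Size zero is split off because [horner_mx] is used at sizes of the form [n.+1]. *)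
case: n K L X => [|n] K L X disj KX; first by rewrite [X]thinmx0.
have [rs] := closed_field_poly_normal (char_poly K).
rewrite (monicP (char_poly_monic K)) scale1r => pE.
have pu : horner_mx L (char_poly K) \in unitmx.
  have : forall a, a \in rs -> ~~ eigenvalue L a.
    move=> a ars; have := disj a; rewrite eigenvalue_root_char pE.
    by rewrite root_prod_XsubC ars.
  rewrite {}pE; elim: rs => [|a rs IH] h.
    by rewrite big_nil rmorph1 unitmx1.
  rewrite big_cons rmorphM /= rmorphB /= horner_mx_X horner_mx_C -mulmxE unitmx_mul.
  rewrite eigenvalueN_unitmx ?h ?mem_head //= IH // => b brs.
  by rewrite h // inE brs orbT.
have := intertwine_horner (char_poly K) KX.
rewrite Cayley_Hamilton mul0mx => /(congr1 (mulmxr (invmx (horner_mx L (char_poly K))))).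
by rewrite /= mul0mx mulmxK.
Qed.

Definition sylvester n (K L X : 'M[F]_n) : 'M[F]_n := K *m X - X *m L.

Lemma sylvester_is_linear n (K L : 'M[F]_n) : linear (sylvester K L).
Proof.
move=> a X Y; rewrite /sylvester mulmxDr mulmxDl -scalemxAr -scalemxAl scalerBr.
by rewrite opprD addrACA.
Qed.

HB.instance Definition _ n (K L : 'M[F]_n) :=
  GRing.isLinear.Build F 'M[F]_n 'M[F]_n _ (sylvester K L) (sylvester_is_linear K L).

(** An injective endomorphism of a finite-dimensional space is invertible. The inverse is recorded
    as one constant matrix on vectorised matrices, so that solutions inherit differentiability from
    the right-hand side. *)
Lemma sylvester_inverse n (K L : 'M[F]_n) :
  (forall a, ~~ (eigenvalue K a && eigenvalue L a)) ->
  exists A : 'M[F]_(n * n), forall X, mxvec X = mxvec (sylvester K L X) *m A.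
Proof.
move=> disj; exists (invmx (lin_mx (sylvester K L))) => X.
have u : lin_mx (sylvester K L) \in unitmx.
  rewrite -row_free_unit -kermx_eq0; apply/eqP/row_matrixP => i.
  rewrite row0; apply: (can_inj (@vec_mxK _ n n)); rewrite linear0.
  apply: (intertwine_eq0 disj); apply/eqP; rewrite -subr_eq0.
  apply/eqP; apply: (can_inj (@mxvecK _ n n)).
  rewrite -[_ - _]/(sylvester K L _) -mul_vec_lin vec_mxK -row_mul mulmx_ker.
  by rewrite row0 linear0.
by rewrite -mul_vec_lin mulmxK.
Qed.

End Sylvester.

(** The same two block matrices, multiplied in either order, give block triangular products whose
    determinants are the two sides. *)
Lemma det_1subM (F : fieldType) n k (U : 'M[F]_(n, k)) (V : 'M[F]_(k, n)) :
  \det (1%:M - U *m V) = \det (1%:M - V *m U).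
Proof.
have h1 : block_mx 1%:M U V 1%:M *m block_mx 1%:M 0 (- V) 1%:M =
   block_mx (1%:M - U *m V) U 0 1%:M.
  by rewrite mulmx_block !mulmx1 !mul1mx !mulmx0 !add0r mulmxN addrN.
have h2 : block_mx 1%:M 0 (- V) 1%:M *m block_mx 1%:M U V 1%:M =
   block_mx 1%:M U 0 (1%:M - V *m U).
  rewrite mulmx_block !mulmx1 !mul1mx !mul0mx !addr0 mulNmx addNr.
  by rewrite [- _ + _]addrC.
have := congr1 determinant h1; have := congr1 determinant h2.
rewrite !det_mulmx !det_ublock !det_lblock !det1 !mulr1 !mul1r.
by move=> -> ->.
Qed.

(** * The dressing matrix built from a Sylvester equation: inverse and determinant *)

Section CauchyMatrix.
Variables (F : fieldType) (n k : nat).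
Variables (K M : 'M[F]_n) (r : 'M[F]_(n, k)) (s : 'M[F]_(k, n)).
Hypotheses (uK : K \in unitmx) (uM : 1%:M + M \in unitmx).
Hypothesis KM : K *m M - M *m K = r *m s.
Local Notation W := (invmx (1%:M + M)).

(** Multiplying [K M - M K = r s] by [K^-1] on both sides yields the commutator of [1 + M] with
    [K^-1]; multiplying that by [W] on both sides yields the commutator of [K^-1] with [W]. *)
Lemma resolvent_rank :
  W *m invmx K *m r *m (s *m invmx K *m W) = invmx K *m W - W *m invmx K.
Proof.
have -> : W *m invmx K *m r *m (s *m invmx K *m W) =
    W *m (invmx K *m (r *m s) *m invmx K) *m W by rewrite !mulmxA.
rewrite -KM mulmxBr mulmxBl !mulmxA mulVmx // mul1mx mulmxK //.
have -> : M *m invmx K - invmx K *m M =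
    (1%:M + M) *m invmx K - invmx K *m (1%:M + M).
  by rewrite mulmxDl mulmxDr mul1mx mulmx1 opprD addrACA subrr add0r.
by rewrite mulmxBr mulmxBl mulKmx // !mulmxA mulmxK.
Qed.

(** The last factor on the left is the inverse of the dressing matrix. This identity both proves
    that and, later, absorbs [v^-1] in the logarithmic derivatives. *)
Lemma resolvent_dressing :
  W *m invmx K *m r *m (1%:M + s *m invmx K *m W *m r) = invmx K *m W *m r.
Proof.
rewrite mulmxDr mulmx1 [X in _ + X]mulmxA resolvent_rank mulmxBl addrC.
by rewrite subrK.
Qed.

Lemma dressing_inverse :
  (1%:M - s *m W *m invmx K *m r) *m (1%:M + s *m invmx K *m W *m r) = 1%:M.
Proof.
set E := 1%:M + s *m invmx K *m W *m r; rewrite mulmxBl mul1mx.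
have -> : s *m W *m invmx K *m r *m E = s *m (W *m invmx K *m r *m E).
  by rewrite !mulmxA.
by rewrite resolvent_dressing !mulmxA addrK.
Qed.

(** Swapping the factors turns the matrix into [1 - W K^-1 r s], which the Sylvester equation
    rewrites as [W K^-1 (1 + M) K]; there the determinants cancel. *)
Lemma det_dressing : \det (1%:M - s *m W *m invmx K *m r) = 1.
Proof.
rewrite -!(mulmxA s) det_1subM -mulmxA -KM mulmxBr !mulmxA.
have -> : 1%:M - (W *m invmx K *m K *m M - W *m invmx K *m M *m K) =
    W *m invmx K *m (1%:M + M) *m K.
  rewrite mulmxKV // mulmxDr mulmx1 mulmxDl mulmxKV // opprB addrCA addrC.
  congr (_ + _); apply/eqP; rewrite subr_eq.
  by rewrite -[X in X + _]mulmx1 -mulmxDr mulVmx.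
rewrite !det_mulmx !det_inv; set a := \det K; set b := \det _.
have a0 : a != 0 by rewrite -unitfE -unitmxE.
have b0 : b != 0 by rewrite -unitfE -unitmxE.
by field; apply/andP.
Qed.
End CauchyMatrix.

(** * Derivatives along a direction [B] of expressions in [s], [W] and [r] *)

Section DirectionalDerivative.
Variables (R : realType) (n k : nat).
Local Notation C := (R[i]).
Variables (M : R -> 'M[C]_n) (r : R -> 'M[C]_(n, k)) (s : R -> 'M[C]_(k, n)).
Variables (t : R) (B : 'M[C]_n).
Hypotheses (uM : 1%:M + M t \in unitmx).
Hypothesis dr : is_derivmx r t (B *m r t).
Hypothesis ds : is_derivmx s t (s t *m B).
Hypothesis dM : is_derivmx M t (B *m M t + M t *m B).
Local Notation W := (fun u => invmx (1%:M + M u)).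

(** In [- W M' W], writing [M' = B (1 + M) + (1 + M) B - 2 B] lets resolvents cancel, so that [M]
    disappears from the result. *)
Lemma is_derivmx_resolvent :
  is_derivmx W t (W t *m B *m W t + W t *m B *m W t - W t *m B - B *m W t).
Proof.
have := is_derivmxV (is_derivmxD (is_derivmx_cst 1%:M t) dM) uM.
congr is_derivmx; rewrite add0r.
have -> : B *m M t + M t *m B =
    B *m (1%:M + M t) + (1%:M + M t) *m B - (B + B).
  by rewrite mulmxDr mulmxDl mulmx1 mul1mx addrACA [RHS]addrAC subrr add0r.
move: uM; set U := 1%:M + M t => uU.
rewrite mulmxBr mulmxBl mulmxDr mulmxDl mulKmx // mulmxA mulmxK //.
by rewrite mulmxDr mulmxDl opprB opprD addrA.
Qed.

(** The term [s B W] coming from [s'] cancels the last term of [s W'], leaving a right multiple of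
    [s W]. *)
Lemma is_derivmx_sW :
  is_derivmx (fun u => s u *m W u) t
    (s t *m W t *m B *m (W t + W t - 1%:M)).
Proof.
have := is_derivmxM ds is_derivmx_resolvent; congr is_derivmx.
by rewrite !mulmxBr !mulmxDr mulmx1 !mulmxA addrCA subrr addr0.
Qed.

Lemma is_derivmx_Wr :
  is_derivmx (fun u => W u *m r u) t
    ((W t + W t - 1%:M) *m B *m (W t *m r t)).
Proof.
have := is_derivmxM is_derivmx_resolvent dr; congr is_derivmx.
rewrite !mulmxBl !mulmxDl mul1mx !mulmxA -[LHS]addrA addrAC.
by rewrite addrA addrAC subrK.
Qed.

(** The form of the middle factor matters: it is unchanged when [B] and [X] are exchanged, which is
    what finally cancels the two Yang-Mills terms. *)
Lemma is_derivmx_sWXWr (X : 'M[C]_n) :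
  is_derivmx (fun u => s u *m W u *m X *m (W u *m r u)) t
    (s t *m W t *m (B *m (W t + W t - 1%:M) *m X + X *m (W t + W t - 1%:M) *m B)
       *m (W t *m r t)).
Proof.
have := is_derivmxM (is_derivmxMr X is_derivmx_sW) is_derivmx_Wr.
by congr is_derivmx; rewrite mulmxDr mulmxDl !mulmxA.
Qed.

(** Commutation makes the [- 1] part of the derivative of [s W] cancel against the term from [r'].
    The case [X = K^-1] differentiates [v]. *)
Lemma is_derivmx_sWXr (X : 'M[C]_n) : B *m X = X *m B ->
  is_derivmx (fun u => s u *m W u *m X *m r u) t
    (s t *m W t *m B *m W t *m X *m r t + s t *m W t *m B *m W t *m X *m r t).
Proof.
move=> BX; have := is_derivmxM (is_derivmxMr X is_derivmx_sW) dr.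
congr is_derivmx; rewrite mulmxBr mulmx1 !mulmxBl !mulmxDr !mulmxDl !mulmxA.
by rewrite -(mulmxA _ B X) BX !mulmxA subrK.
Qed.
End DirectionalDerivative.

(** * Entrywise conjugation of matrices *)

Section Conjugation.
Variable R : realType.
Local Notation C := (R[i]).

Lemma mconjM m n p (A : 'M[C]_(m, n)) (B : 'M[C]_(n, p)) :
  mconj (A *m B) = mconj A *m mconj B.
Proof. exact: (map_mxM Num.conj). Qed.

Lemma mconjD m n (A B : 'M[C]_(m, n)) : mconj (A + B) = mconj A + mconj B.
Proof. exact: (map_mxD Num.conj). Qed.

Lemma mconjN m n (A : 'M[C]_(m, n)) : mconj (- A) = - mconj A.
Proof. exact: (map_mxN Num.conj). Qed.

Lemma mconjZ m n (c : C) (A : 'M[C]_(m, n)) : mconj (c *: A) = c^* *: mconj A.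
Proof. exact: (map_mxZ Num.conj). Qed.

Lemma mconj1 n : mconj 1%:M = 1%:M :> 'M[C]_n.
Proof. exact: (map_mx1 Num.conj). Qed.

Lemma mconjK m n (A : 'M[C]_(m, n)) : mconj (mconj A) = A.
Proof. by apply/matrixP => i j; rewrite !mxE conjCK. Qed.

Lemma mconj_inv n (A : 'M[C]_n) : mconj (invmx A) = invmx (mconj A).
Proof. exact: (map_invmx Num.conj). Qed.

Lemma mconj_unit n (A : 'M[C]_n) : (mconj A \in unitmx) = (A \in unitmx).
Proof. exact: (map_unitmx Num.conj). Qed.

Lemma mconjX n (A : 'M[C]_n) k : mconj (A ^+ k) = mconj A ^+ k.
Proof.
elim: k => [|k IH]; first by rewrite !expr0; exact: mconj1.
by rewrite !exprS -!mulmxE mconjM IH.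
Qed.

Lemma mconj_adj m n (A : 'M[C]_(m, n)) : mconj (adjmx A) = A^T.
Proof. by apply/matrixP => i j; rewrite !mxE conjCK. Qed.

Lemma mconj_tr m n (A : 'M[C]_(m, n)) : mconj A^T = adjmx A.
Proof. by apply/matrixP => i j; rewrite !mxE. Qed.
End Conjugation.

(** * Definiteness of Hermitian two by two matrices of determinant one *)

Lemma det_mx22 (F : comNzRingType) (A : 'M[F]_2) :
  \det A = A 0 0 * A 1 1 - A 0 1 * A 1 0.
Proof.
rewrite (expand_det_row _ 0) !big_ord_recl big_ord0 addr0 /cofactor !det_mx11 !mxE.
have -> : lift ord0 ord0 = 1 :> 'I_2 by apply/val_inj.
have -> : lift 1 0 = 0 :> 'I_2 by apply/val_inj.
by rewrite /= expr0 expr1 mul1r mulN1r mulrN.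
Qed.

Section Definite.
Variable R : realType.
Local Notation C := (R[i]).

Lemma hermitian_det1_definite (A : 'M[C]_2) :
  adjmx A = A -> \det A = 1 -> posdef A \/ negdef A.
Proof.
move=> Aadj; rewrite det_mx22.
set a := A 0 0; set b := A 0 1; set c := A 1 0; set d := A 1 1 => det1.
have ha : a^* = a by move/matrixP: Aadj => /(_ 0 0); rewrite !mxE.
have hb : c = b^* by move/matrixP: Aadj => /(_ 1 0); rewrite !mxE => ->.
(* Completing the square; the coefficient of the second square is the determinant, here 1. Hence the
   form has the sign of [a]. *)
have formE (x : 'cV[C]_2) : a * (adjmx x *m A *m x) 0 0 =
    `|a * x 0 0 + b * x 1 0| ^+ 2 + `|x 1 0| ^+ 2.
  have dE : a * d = 1 + b * b^* by rewrite -hb -det1 subrK.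
  rewrite !normCK rmorphD !rmorphM /= ha.
  rewrite !mxE !big_ord_recl !big_ord0 !mxE !big_ord_recl !big_ord0 !mxE.
  have -> : lift ord0 ord0 = 1 :> 'I_2 by apply/val_inj.
  rewrite -/a -/b -/c -/d hb !addr0.
  transitivity (a * (x 0 0)^* * (a * x 0 0) + a * (x 0 0)^* * (b * x 1 0)
    + a * (x 1 0)^* * b^* * x 0 0 + (a * d) * (x 1 0)^* * x 1 0); first by ring.
  by rewrite dE; ring.
(* If [a = 0], the determinant condition reads [1 + |b|^2 = 0]. *)
have a0 : a != 0.
  apply/negP => /eqP a0; have : (0 : C) < 0; last by rewrite ltxx.
  apply: (@lt_le_trans _ _ (1 + b * b^*)).
    by rewrite ltr_pwDl ?ltr01 // mul_conjC_ge0.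
  by rewrite -hb -det1 subrK a0 mul0r.
have form_gt0 (x : 'cV[C]_2) : x != 0 -> 0 < a * (adjmx x *m A *m x) 0 0.
  move=> x0; rewrite formE; have [x1|x1] := eqVneq (x 1 0) 0.
    rewrite x1 mulr0 addr0 normr0 expr0n addr0 exprn_gt0 // normr_gt0 mulf_neq0 //.
    apply: contra x0 => /eqP x00; apply/eqP/matrixP => i j.
    rewrite (ord1 j) mxE; case: (unliftP 0 i) => [k|] -> //.
    by rewrite (ord1 k); have -> : lift 0 0 = 1 :> 'I_2 by apply/val_inj.
  by rewrite ltr_wpDl ?exprn_ge0 // exprn_gt0 // normr_gt0.
have : a \is Num.real by rewrite CrealE ha.
case/real_ge0P => sa; [left|right] => x /form_gt0.
- by rewrite pmulr_rgt0 // lt_def a0.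
- by rewrite nmulr_rgt0.
Qed.
End Definite.

(** * Entries, inverses and products of two by two and block matrices *)

Lemma block_mx22E (F : Type) (a b c d : 'M[F]_1) :
  ((block_mx a b c d : 'M_2) 0 0 = a 0 0) * ((block_mx a b c d : 'M_2) 0 1 = b 0 0) *
  ((block_mx a b c d : 'M_2) 1 0 = c 0 0) * ((block_mx a b c d : 'M_2) 1 1 = d 0 0).
Proof.
have e0 : (0 : 'I_2) = lshift 1 (0 : 'I_1) by apply/val_inj.
have e1 : (1 : 'I_2) = rshift 1 (0 : 'I_1) by apply/val_inj.
rewrite e0 e1; split; [split; [split|]|].
- exact: block_mxEul.
- exact: block_mxEur.
- exact: block_mxEdl.
- exact: block_mxEdr.
Qed.

Lemma ord2_ind (P : 'I_2 -> Prop) : P 0 -> P 1 -> forall i, P i.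
Proof.
move=> P0 P1 i; case: (unliftP 0 i) => [j|] ->; last exact: P0.
by rewrite (ord1 j) (_ : lift 0 0 = 1) //; apply/val_inj.
Qed.

Lemma mx22P (F : Type) (A B : 'M[F]_2) : A 0 0 = B 0 0 -> A 0 1 = B 0 1 ->
  A 1 0 = B 1 0 -> A 1 1 = B 1 1 -> A = B.
Proof.
by move=> *; apply/matrixP => i j; elim/ord2_ind: i; elim/ord2_ind: j.
Qed.

Lemma mx2_eta (R : realType) (A : 'M[R[i]]_2) :
  A = mx2 (A 0 0) (A 0 1) (A 1 0) (A 1 1).
Proof. by apply: mx22P; rewrite mxE. Qed.

(** With determinant 1 the adjugate is a left inverse, and it coincides with the given right
    inverse. *)
Lemma inverse_mx22 (R : realType) (V E : 'M[R[i]]_2) :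
  V *m E = 1%:M -> \det V = 1 ->
  [/\ E 0 0 = V 1 1, E 0 1 = - V 0 1, E 1 0 = - V 1 0 & E 1 1 = V 0 0].
Proof.
move=> VE; rewrite det_mx22 => dV.
pose A := mx2 (V 1 1) (- V 0 1) (- V 1 0) (V 0 0).
have AV : A *m V = 1%:M.
  have e1 : lift ord0 ord0 = 1 :> 'I_2 by apply/val_inj.
  by apply: mx22P; rewrite !mxE !big_ord_recl big_ord0 !mxE /= ?e1 ?mulr1n ?mulr0n
    -?dV; ring.
have <- : A = E by rewrite -[LHS]mulmx1 -VE mulmxA AV mul1mx.
by split; rewrite mxE.
Qed.

Lemma mul_antidiag_block (F : nzRingType) p q p' (a : 'M[F]_(p, q)) (b : 'M[F]_(p, q))
    (w1 w2 w3 w4 : 'M[F]_q) (k1 k2 : 'M[F]_q) (r1 r2 : 'M[F]_(q, p')) :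
  block_mx 0 a b 0 *m block_mx w1 w2 w3 w4 *m block_mx k1 0 0 k2 *m block_mx r1 0 0 r2
  = block_mx (a *m w3 *m k1 *m r1) (a *m w4 *m k2 *m r2)
             (b *m w1 *m k1 *m r1) (b *m w2 *m k2 *m r2).
Proof. by do 3!rewrite mulmx_block !(mul0mx, mulmx0, addr0, add0r). Qed.

Lemma mul_antidiag_diag_block (F : nzRingType) p q p' (a : 'M[F]_(p, q)) (b : 'M[F]_(p, q))
    (w1 w2 w3 w4 : 'M[F]_q) (k1 k2 : 'M[F]_q) (r1 r2 : 'M[F]_(q, p')) :
  block_mx 0 a b 0 *m block_mx k1 0 0 k2 *m block_mx w1 w2 w3 w4 *m block_mx r1 0 0 r2
  = block_mx (a *m k2 *m w3 *m r1) (a *m k2 *m w4 *m r2)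
             (b *m k1 *m w1 *m r1) (b *m k1 *m w2 *m r2).
Proof. by do 3!rewrite mulmx_block !(mul0mx, mulmx0, addr0, add0r). Qed.

Lemma congr_block_mx (F : Type) m1 m2 n1 n2 (a a' : 'M[F]_(m1, n1))
    (b b' : 'M[F]_(m1, n2)) (c c' : 'M[F]_(m2, n1)) (d d' : 'M[F]_(m2, n2)) :
  a = a' -> b = b' -> c = c' -> d = d' -> block_mx a b c d = block_mx a' b' c' d'.
Proof. by move=> -> -> -> ->. Qed.

(** * The doubled system, and the Hermitian symmetry of [v] *)

Section BlockSystem.
Variables (R : realType) (N : nat).
Local Notation C := (R[i]).
Implicit Types (K M P : 'M[C]_N) (r s : 'cV[C]_N).

Definition bigK K : 'M[C]_(N + N) := block_mx K 0 0 (- invmx (mconj K)).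
Definition bigM M : 'M[C]_(N + N) := block_mx 0 M (mconj M) 0.
Definition bigr K r : 'M[C]_(N + N, 1 + 1) :=
  block_mx r 0 0 (invmx (mconj K) *m mconj r).
Definition bigs K s : 'M[C]_(1 + 1, N + N) :=
  block_mx 0 (- (adjmx s *m invmx (mconj K))) s^T 0.
Definition bigB P : 'M[C]_(N + N) := block_mx P 0 0 (mconj P).
Definition bigW M : 'M[C]_(N + N) := invmx (1%:M + bigM M).

Lemma invmx_right n (A B : 'M[C]_n) : A *m B = 1%:M -> A \in unitmx /\ invmx A = B.
Proof.
move=> AB; have [uA _] := mulmx1_unit AB; split => //.
by rewrite -[LHS]mulmx1 -AB mulKmx.
Qed.

Lemma bigKV K : K \in unitmx ->
  bigK K \in unitmx /\ invmx (bigK K) = block_mx (invmx K) 0 0 (- mconj K).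
Proof.
move=> uK; apply: invmx_right; rewrite /bigK mulmx_block.
rewrite !mul0mx !mulmx0 !addr0 !add0r mulmxV // mulmxN mulNmx opprK mulVmx ?mconj_unit //.
by rewrite -scalar_mx_block.
Qed.

(** The upper right block is the hypothesis. The lower left block is its conjugate, multiplied on
    the left by the inverse of [mconj K] and on the right by [K]. *)
Lemma bigK_sylvester K M r s : K \in unitmx ->
  K *m M + M *m invmx (mconj K) = - (r *m adjmx s *m invmx (mconj K)) ->
  bigK K *m bigM M - bigM M *m bigK K = bigr K r *m bigs K s.
Proof.
move=> uK KM; have uK' : mconj K \in unitmx by rewrite mconj_unit.
rewrite /bigK /bigM /bigr /bigs !mulmx_block !mul0mx !mulmx0 !addr0 !add0r.
rewrite opp_block_mx add_block_mx !oppr0 !addr0; congr block_mx.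
  by rewrite mulmxN opprK KM mulmxN mulmxA.
have := congr1 mconj KM.
rewrite mconjD mconjN !mconjM mconj_inv mconjK mconj_adj => KMc.
have := congr1 (fun X => invmx (mconj K) *m X *m K) KMc.
rewrite /= mulmxDr mulmxDl mulmxN mulNmx !mulmxA mulVmx // mul1mx !mulmxKV //.
by move=> e; rewrite mulNmx -opprD addrC e opprK.
Qed.

Section Domain.
Variable M : 'M[C]_N.
Hypothesis uM : 1%:M - mconj M *m M \in unitmx.
Local Notation D1 := (invmx (1%:M - M *m mconj M)).
Local Notation D2 := (invmx (1%:M - mconj M *m M)).

Lemma mconj_D2 : mconj D2 = D1.
Proof. by rewrite mconj_inv mconjD mconj1 mconjN mconjM mconjK. Qed.

Lemma mconj_D1 : mconj D1 = D2.
Proof. by rewrite -mconj_D2 mconjK. Qed.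

Lemma dom_conj : 1%:M - M *m mconj M \in unitmx.
Proof. by rewrite -mconj_unit mconjD mconj1 mconjN mconjM mconjK. Qed.

(** Push-through identity: with [M'] the conjugate of [M], both [M' (1 - M M')] and [(1 - M' M) M']
    equal [M' - M' M M']. *)
Lemma dom_push : D2 *m mconj M = mconj M *m D1.
Proof.
apply: (can_inj (mulKmx uM)); rewrite mulKVmx // mulmxA mulmxBl mul1mx.
rewrite -[X in _ = (X - _) *m _]mulmx1 -!mulmxA -mulmxBr.
by rewrite mulmxK // dom_conj.
Qed.

(** Block inversion: the diagonal blocks are the inverses of the two Schur complements, both
    available on the domain. *)
Lemma bigWE : (1%:M + bigM M \in unitmx) /\
  bigW M = block_mx D1 (- (M *m D2)) (- (mconj M *m D1)) D2.
Proof.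
apply: invmx_right; rewrite /bigM scalar_mx_block add_block_mx !addr0 !add0r.
rewrite mulmx_block !mul1mx !mulmxN !mulmxA addNr subrr.
have eD n (A D : 'M[C]_n) : D - A *m D = (1%:M - A) *m D.
  by rewrite mulmxBl mul1mx.
rewrite [- _ + _]addrC !eD.
by rewrite !mulmxV ?dom_conj // -scalar_mx_block.
Qed.
End Domain.

Definition bigv K r s M : 'M[C]_(1 + 1) :=
  1%:M - bigs K s *m bigW M *m invmx (bigK K) *m bigr K r.
Definition bigvV K r s M : 'M[C]_(1 + 1) :=
  1%:M + bigs K s *m invmx (bigK K) *m bigW M *m bigr K r.

Section Entries.
Variables (K M : 'M[C]_N) (r s : 'cV[C]_N).
Hypothesis uK : K \in unitmx.
Hypothesis uM : 1%:M - mconj M *m M \in unitmx.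
Local Notation D1 := (invmx (1%:M - M *m mconj M)).
Local Notation D2 := (invmx (1%:M - mconj M *m M)).

Lemma bigvE : bigv K r s M = block_mx
  (1%:M - adjmx s *m invmx (mconj K) *m mconj M *m D1 *m invmx K *m r)
  (- (adjmx s *m invmx (mconj K) *m D2 *m mconj r))
  (- (s^T *m D1 *m invmx K *m r))
  (1%:M - s^T *m M *m D2 *m mconj r).
Proof.
have uK' : mconj K \in unitmx by rewrite mconj_unit.
rewrite /bigv (proj2 (bigWE uM)) (proj2 (bigKV uK)) mul_antidiag_block.
rewrite (@scalar_mx_block _ 1 1) opp_block_mx add_block_mx.
move: (mulmxV uK'); move: D1 D2 (invmx K) (invmx (mconj K)) => d1 d2 kv kcv kk.
apply: congr_block_mx; rewrite ?add0r.
- by rewrite !mulmxN !mulNmx opprK !mulmxA.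
- by rewrite !mulmxN !mulNmx opprK !mulmxA -(mulmxA _ (mconj K)) kk mulmx1.
- by [].
- by rewrite !mulmxN !mulNmx opprK !mulmxA -(mulmxA _ (mconj K)) kk mulmx1.
Qed.

Lemma bigvVE : bigvV K r s M = block_mx
  (1%:M - adjmx s *m mconj M *m D1 *m r)
  (adjmx s *m D2 *m invmx (mconj K) *m mconj r)
  (s^T *m invmx K *m D1 *m r)
  (1%:M - s^T *m invmx K *m M *m D2 *m invmx (mconj K) *m mconj r).
Proof.
have uK' : mconj K \in unitmx by rewrite mconj_unit.
rewrite /bigvV (proj2 (bigWE uM)) (proj2 (bigKV uK)) mul_antidiag_diag_block.
rewrite (@scalar_mx_block _ 1 1) add_block_mx.
move: (mulVmx uK'); move: D1 D2 (invmx K) (invmx (mconj K)) => d1 d2 kv kcv kk.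
have -> : - (adjmx s *m kcv) *m - mconj K = adjmx s.
  by rewrite mulNmx mulmxN opprK -mulmxA kk mulmx1.
apply: congr_block_mx; rewrite ?add0r ?mulmxA.
- by rewrite !mulmxN !mulNmx !mulmxA.
- by [].
- by [].
- by rewrite !mulmxN !mulNmx !mulmxA.
Qed.

Hypothesis KM :
  K *m M + M *m invmx (mconj K) = - (r *m adjmx s *m invmx (mconj K)).

Lemma bigv_det : \det (bigv K r s M) = 1.
Proof.
exact: (det_dressing (proj1 (bigKV uK)) (proj1 (bigWE uM)) (bigK_sylvester uK KM)).
Qed.

Lemma bigvK : bigv K r s M *m bigvV K r s M = 1%:M.
Proof.
exact: (dressing_inverse (proj1 (bigKV uK)) (proj1 (bigWE uM)) (bigK_sylvester uK KM)).
Qed.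

Lemma conj_oppmx11 (A : 'M[C]_1) : ((- A) 0 0)^* = - mconj A 0 0.
Proof. by rewrite !mxE rmorphN. Qed.

Lemma conj_1submx11 (A : 'M[C]_1) : ((1%:M - A) 0 0)^* = (1%:M - mconj A) 0 0.
Proof. by rewrite !mxE rmorphB rmorph1. Qed.

(** The adjugate identifies the 01 entry of [v] with minus that of [v^-1], whose explicit formula is
    minus the conjugate of the 10 entry of [v]. *)
Lemma bigv_offdiag : bigv K r s M 0 1 = (bigv K r s M 1 0)^*.
Proof.
have [_ e01 _ _] := inverse_mx22 bigvK bigv_det.
transitivity (- bigvV K r s M 0 1); first by rewrite e01 opprK.
transitivity (- (adjmx s *m D2 *m invmx (mconj K) *m mconj r) 0 0).
  by congr (- _); rewrite bigvVE; exact: (block_mx22E _ _ _ _).1.1.2.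
transitivity ((- (s^T *m D1 *m invmx K *m r)) 0 0)^*.
  rewrite conj_oppmx11; congr (- (fun_of_matrix _ 0 0)).
  by rewrite !mconjM mconj_tr mconj_D1 mconj_inv.
by congr (_^*); rewrite bigvE; exact/esym/(block_mx22E _ _ _ _).1.2.
Qed.

(** Two entries differ in form: the upper right one is a conjugate by definition in [vmat], settled
    by [bigv_offdiag], and the upper left one needs [dom_push]. *)
Lemma vmat_bigv : vmat K r s M = bigv K r s M.
Proof.
have -> : bigv K r s M = mx2 (bigv K r s M 0 0) (bigv K r s M 0 1)
    (bigv K r s M 1 0) (bigv K r s M 1 1) by exact: mx2_eta.
rewrite bigv_offdiag bigvE !block_mx22E /vmat.
rewrite -(mulmxA _ D2) (dom_push uM) !mulmxA.
by congr mx2; rewrite !mxE ?eqxx ?rmorphN.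
Qed.

(** For the diagonal, conjugating the explicit 00 entry of [v] gives the explicit 11 entry of
    [v^-1], which the adjugate identifies with the 00 entry of [v]; the 11 entry is treated
    alike. *)
Lemma bigv_hermitian : adjmx (bigv K r s M) = bigv K r s M.
Proof.
have [e00 _ _ e11] := inverse_mx22 bigvK bigv_det.
have adjE i j : adjmx (bigv K r s M) i j = (bigv K r s M j i)^* by rewrite !mxE.
apply: mx22P; rewrite adjE.
- transitivity (bigvV K r s M 1 1); last exact: e11.
  transitivity ((1%:M - adjmx s *m invmx (mconj K) *m mconj M *m D1 *m invmx K *m r) 0 0)^*.
    by congr (_^*); rewrite bigvE; exact: (block_mx22E _ _ _ _).1.1.1.
  rewrite conj_1submx11 !mconjM mconj_adj mconj_D1 !mconj_inv !mconjK.
  by rewrite bigvVE; exact/esym/(block_mx22E _ _ _ _).2.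
- by rewrite bigv_offdiag.
- by rewrite bigv_offdiag conjCK.
- transitivity (bigvV K r s M 0 0); last exact: e00.
  transitivity ((1%:M - s^T *m M *m D2 *m mconj r) 0 0)^*.
    by congr (_^*); rewrite bigvE; exact: (block_mx22E _ _ _ _).2.
  rewrite conj_1submx11 !mconjM mconj_tr mconj_D2 mconjK.
  by rewrite bigvVE; exact/esym/(block_mx22E _ _ _ _).1.1.1.
Qed.

End Entries.
End BlockSystem.

(** * Evolution of the doubled data along one real variable *)

Section Flow.
Variables (R : realType) (N : nat).
Local Notation C := (R[i]).

Lemma is_derivmx_mxvec m n (F : R -> 'M[C]_(m, n)) t D :
  is_derivmx F t D -> is_derivmx (fun u => mxvec (F u)) t (mxvec D).
Proof.
move=> hF i j; rewrite (ord1 i); case/mxvec_indexP: j => k l.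
by rewrite mxvecE; under eq_fun do rewrite mxvecE.
Qed.

Lemma is_derivmx_vec_mx m n (F : R -> 'rV[C]_(m * n)) t D :
  is_derivmx F t D -> is_derivmx (fun u => vec_mx (F u)) t (vec_mx D).
Proof. by move=> hF i j; rewrite mxE; under eq_fun do rewrite mxE. Qed.

Variables (K P : 'M[C]_N) (rho sig : R -> 'cV[C]_N) (mu : R -> 'M[C]_N) (t : R).
Hypothesis uK : K \in unitmx.
Hypothesis disj : forall a, ~~ (eigenvalue K a && eigenvalue (- invmx (mconj K)) a).
Hypothesis syl : forall u,
  K *m mu u + mu u *m invmx (mconj K) = - (rho u *m adjmx (sig u) *m invmx (mconj K)).
Hypothesis KP : K *m P = P *m K.
Hypothesis drho : is_derivmx rho t (P *m rho t).
Hypothesis dsig : is_derivmx sig t (P^T *m sig t).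
Local Notation Kc := (mconj K).

Lemma commute_invmx n (A B : 'M[C]_n) : A \in unitmx -> A *m B = B *m A ->
  invmx A *m B = B *m invmx A.
Proof.
move=> uA AB; apply: (can_inj (mulKmx uA)).
by rewrite mulKVmx // mulmxA AB mulmxK.
Qed.

Lemma mconj_commute : invmx Kc *m mconj P = mconj P *m invmx Kc.
Proof. by apply: commute_invmx; rewrite ?mconj_unit // -!mconjM KP. Qed.

Lemma is_derivmx_adj_sig : is_derivmx (fun u => adjmx (sig u)) t
  (adjmx (sig t) *m mconj P).
Proof.
have := is_derivmx_tr (is_derivmx_conj dsig); congr is_derivmx.
by rewrite mconjM trmx_mul /adjmx; congr (_ *m _); apply/matrixP => i j; rewrite !mxE.
Qed.

(* The Sylvester operator is invertible, so [mu] is a constant linear image of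
   its right-hand side: this is what makes [mu] differentiable. *)
Lemma is_derivmx_mu : is_derivmx mu t (P *m mu t + mu t *m mconj P).
Proof.
pose f u := - (rho u *m adjmx (sig u) *m invmx Kc).
have sylf u : sylvester K (- invmx Kc) (mu u) = f u.
  by rewrite /sylvester mulmxN opprK syl.
have df : is_derivmx f t (P *m f t + f t *m mconj P).
  have := is_derivmxMl (- 1%:M)
    (is_derivmxMr (invmx Kc) (is_derivmxM drho is_derivmx_adj_sig)).
  rewrite mulNmx mul1mx; under eq_fun do rewrite mulNmx mul1mx.
  congr is_derivmx; rewrite /f mulmxN mulNmx -opprD; congr (- _).
  by rewrite mulmxDl -!mulmxA mconj_commute.
have [A hA] := sylvester_inverse disj.
have muE : mu = fun u => vec_mx (mxvec (f u) *m A).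
  by apply/funext => u; rewrite -sylf -hA mxvecK.
have [D hD] : exists D, is_derivmx mu t D.
  by rewrite muE; eexists; apply/is_derivmx_vec_mx/is_derivmxMr/is_derivmx_mxvec/df.
(* Differentiating the Sylvester equation shows that both sides have the same image under the
   injective Sylvester operator. *)
suff -> : P *m mu t + mu t *m mconj P = D by [].
apply/eqP; rewrite -subr_eq0; apply/eqP; apply: (intertwine_eq0 disj).
apply/eqP; rewrite -subr_eq0 -/(sylvester _ _ _) linearB /=.
have -> : sylvester K (- invmx Kc) D = P *m f t + f t *m mconj P.
  apply: is_derivmx_uniq df; rewrite -(funext sylf) /sylvester.
  have := is_derivmxD (is_derivmxMl K hD)
    (is_derivmxMr (invmx Kc) hD).
  by rewrite mulmxN opprK; under [X in _ -> is_derivmx X _ _]eq_fun do rewrite mulmxN opprK.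
rewrite subr_eq0 -sylf /sylvester !mulmxN !opprK; apply/eqP.
rewrite !mulmxDr !mulmxDl !mulmxA KP -(mulmxA _ (invmx Kc)) mconj_commute.
by rewrite mulmxA addrACA.
Qed.

Lemma is_derivmx_bigr : is_derivmx (fun u => bigr K (rho u)) t
  (bigB P *m bigr K (rho t)).
Proof.
have := is_derivmx_block drho (is_derivmx_cst 0 t) (is_derivmx_cst 0 t)
  (is_derivmxMl (invmx Kc) (is_derivmx_conj drho)).
congr is_derivmx; rewrite /bigB /bigr mulmx_block !(mul0mx, mulmx0, addr0, add0r).
by rewrite mconjM !mulmxA mconj_commute.
Qed.

Lemma is_derivmx_bigs : is_derivmx (fun u => bigs K (sig u)) t
  (bigs K (sig t) *m bigB P).
Proof.
have hN : is_derivmx (fun u => - (adjmx (sig u) *m invmx Kc)) t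
    (- (adjmx (sig t) *m invmx Kc *m mconj P)).
  have := is_derivmxMl (- 1%:M) (is_derivmxMr (invmx Kc) is_derivmx_adj_sig).
  rewrite mulNmx mul1mx -!mulmxA mconj_commute.
  by under eq_fun do rewrite mulNmx mul1mx.
have := is_derivmx_block (is_derivmx_cst 0 t) hN (is_derivmx_tr dsig) (is_derivmx_cst 0 t).
congr is_derivmx; rewrite /bigB /bigs mulmx_block !(mul0mx, mulmx0, addr0, add0r).
by rewrite trmx_mul trmxK mulNmx.
Qed.

Lemma is_derivmx_bigM : is_derivmx (fun u => bigM (mu u)) t
  (bigB P *m bigM (mu t) + bigM (mu t) *m bigB P).
Proof.
have := is_derivmx_block (is_derivmx_cst 0 t) is_derivmx_mu
  (is_derivmx_conj is_derivmx_mu) (is_derivmx_cst 0 t).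
congr is_derivmx; rewrite /bigB /bigM !mulmx_block !(mul0mx, mulmx0, addr0, add0r).
by rewrite add_block_mx !addr0 mconjD !mconjM mconjK.
Qed.

Lemma bigB_commute : bigB P *m invmx (bigK K) = invmx (bigK K) *m bigB P.
Proof.
apply/esym; apply: commute_invmx; first exact: (proj1 (bigKV uK)).
rewrite /bigK /bigB !mulmx_block !(mul0mx, mulmx0, addr0, add0r) KP.
by rewrite mulNmx mulmxN mconj_commute.
Qed.

Hypothesis dom : 1%:M - mconj (mu t) *m mu t \in unitmx.

Lemma dom_near : \forall u \near t, 1%:M - mconj (mu u) *m mu u \in unitmx.
Proof.
have h := is_derivmxD (is_derivmx_cst 1%:M t) (is_derivmxMl (- 1%:M)
  (is_derivmxM (is_derivmx_conj is_derivmx_mu) is_derivmx_mu)).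
have := is_derivmx_unit h; rewrite mulNmx mul1mx => /(_ dom).
by apply: filterS => u; rewrite mulNmx mul1mx.
Qed.

(** The block formula for [v] holds only on the domain, which contains a neighbourhood of [t] on the
    line by [dom_near]. *)
Lemma is_derivmx_vmat :
  let A := bigs K (sig t) *m bigW (mu t) *m bigB P *m bigW (mu t)
           *m invmx (bigK K) *m bigr K (rho t) in
  is_derivmx (fun u => vmat K (rho u) (sig u) (mu u)) t (- (A + A)).
Proof.
move=> A.
have h := is_derivmx_sWXr (proj1 (bigWE dom)) is_derivmx_bigr is_derivmx_bigs
  is_derivmx_bigM bigB_commute.
have := is_derivmxD (is_derivmx_cst (1%:M : 'M[C]_2) t) (is_derivmxMl (- 1%:M) h).
rewrite add0r mulNmx mul1mx; apply: near_eq_is_derivmx.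
apply: filterS dom_near => u du.
by rewrite mulNmx mul1mx (vmat_bigv uK du (syl u)).
Qed.

Lemma is_derivmx_current (X : 'M[C]_(N + N)) :
  is_derivmx (fun u => bigs K (sig u) *m bigW (mu u) *m X *m
                       (bigW (mu u) *m bigr K (rho u))) t
    (bigs K (sig t) *m bigW (mu t) *m
      (bigB P *m (bigW (mu t) + bigW (mu t) - 1%:M) *m X
       + X *m (bigW (mu t) + bigW (mu t) - 1%:M) *m bigB P)
      *m (bigW (mu t) *m bigr K (rho t))).
Proof.
exact: (is_derivmx_sWXWr (proj1 (bigWE dom)) is_derivmx_bigr is_derivmx_bigs
  is_derivmx_bigM).
Qed.
End Flow.

(** * Direction matrices of the flows and their Wirtinger combinations *)

Section Directions.
Variables (R : realType) (N : nat).
Local Notation C := (R[i]).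
Implicit Type K : 'M[C]_N.

Definition flow_xi K k : 'M[C]_N := K ^+ k + (-1) ^+ k.+1 *: invmx K ^+ k.
Definition flow_eta K k : 'M[C]_N := 'i%C *: (K ^+ k - (-1) ^+ k.+1 *: invmx K ^+ k).

Lemma exprmxSr n (A : 'M[C]_n) k : A ^+ k.+1 = A ^+ k *m A.
Proof. by rewrite exprSr mulmxE. Qed.

Lemma trmxX n (A : 'M[C]_n) k : (A ^+ k)^T = A^T ^+ k.
Proof.
elim: k => [|k IH]; first by rewrite !expr0; exact: trmx1.
by rewrite exprmxSr trmx_mul IH exprS mulmxE.
Qed.

Lemma commute_exp n (A B : 'M[C]_n) k : A *m B = B *m A -> A *m B ^+ k = B ^+ k *m A.
Proof. by rewrite !mulmxE; exact: (@commrX _ A B). Qed.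

Lemma commute_inv_exp K k : K \in unitmx -> K *m invmx K ^+ k = invmx K ^+ k *m K.
Proof. by move=> uK; apply: commute_exp; rewrite mulmxV ?mulVmx. Qed.

Lemma flow_xi_commute K k : K \in unitmx -> K *m flow_xi K k = flow_xi K k *m K.
Proof.
move=> uK; rewrite /flow_xi mulmxDr mulmxDl -scalemxAr -scalemxAl.
by rewrite commute_inv_exp // commute_exp.
Qed.

Lemma flow_eta_commute K k : K \in unitmx -> K *m flow_eta K k = flow_eta K k *m K.
Proof.
move=> uK; rewrite /flow_eta -scalemxAr -scalemxAl mulmxBr mulmxBl.
by rewrite -scalemxAr -scalemxAl commute_inv_exp // commute_exp.
Qed.

Lemma flow_xi_tr K k :
  (flow_xi K k)^T = K^T ^+ k + (-1) ^+ k.+1 *: invmx K^T ^+ k.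
Proof. by rewrite /flow_xi linearD linearZ /= !trmxX trmx_inv. Qed.

Lemma flow_eta_tr K k :
  (flow_eta K k)^T = 'i%C *: (K^T ^+ k - (-1) ^+ k.+1 *: invmx K^T ^+ k).
Proof. by rewrite /flow_eta linearZ linearB linearZ /= !trmxX trmx_inv. Qed.

(** One formula for both operators: [c = -i] for [d_z] and [c = i] for [d_zbar]. It is applied to
    derivatives and to direction matrices alike. *)
Definition wirtinger (c : C) m n (X Y : 'M[C]_(m, n)) := 2^-1 *: (X + c *: Y).

Lemma wirtingerMl c m n p (A : 'M[C]_(m, n)) (X Y : 'M[C]_(n, p)) :
  wirtinger c (A *m X) (A *m Y) = A *m wirtinger c X Y.
Proof. by rewrite /wirtinger -scalemxAr mulmxDr -scalemxAr. Qed.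

Lemma wirtingerMr c m n p (X Y : 'M[C]_(m, n)) (A : 'M[C]_(n, p)) :
  wirtinger c (X *m A) (Y *m A) = wirtinger c X Y *m A.
Proof. by rewrite /wirtinger -scalemxAl mulmxDl -scalemxAl. Qed.

Lemma wirtingerD c m n (X X' Y Y' : 'M[C]_(m, n)) :
  wirtinger c (X + X') (Y + Y') = wirtinger c X Y + wirtinger c X' Y'.
Proof. by rewrite /wirtinger -scalerDr (scalerDr c) addrACA. Qed.

Lemma wirtingerN c m n (X Y : 'M[C]_(m, n)) :
  wirtinger c (- X) (- Y) = - wirtinger c X Y.
Proof. by rewrite /wirtinger scalerN -opprD scalerN. Qed.

(** [bigB] is only real-linear, so the combination is taken after doubling; the result need not have
    conjugate diagonal blocks. *)
Definition bigZ K k := wirtinger (- 'i%C) (bigB (flow_xi K k)) (bigB (flow_eta K k)).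
Definition bigZb K k := wirtinger 'i%C (bigB (flow_xi K k)) (bigB (flow_eta K k)).

Lemma conjc_i : ('i%C : C)^* = - 'i%C.
Proof. by rewrite complexiE conjCi. Qed.

Lemma half_add (V : lmodType C) (x : V) : 2^-1 *: (x + x) = x.
Proof. by rewrite -[x + x]mulr2n -[x *+ 2]scaler_nat scalerA mulVf ?scale1r // pnatr_eq0. Qed.

(** The flows in xi and eta have the shapes [X + Y] and [i (X - Y)]; the two Wirtinger combinations
    separate the summands. *)
Lemma wirtinger_i m n (c : C) (X Y : 'M[C]_(m, n)) : c * 'i%C = 1 ->
  wirtinger c (X + Y) ('i%C *: (X - Y)) = X.
Proof.
by move=> ci; rewrite /wirtinger scalerA ci scale1r addrACA subrr addr0 half_add.
Qed.

Lemma wirtinger_Ni m n (c : C) (X Y : 'M[C]_(m, n)) : c * 'i%C = - 1 ->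
  wirtinger c (X + Y) ('i%C *: (X - Y)) = Y.
Proof.
move=> ci; rewrite /wirtinger scalerA ci scaleN1r opprB addrC addrA addrNK.
by rewrite half_add.
Qed.

Lemma wirtinger_block c m1 m2 n1 n2 (a a' : 'M[C]_(m1, n1)) (d d' : 'M[C]_(m2, n2)) :
  wirtinger c (block_mx a 0 0 d) (block_mx a' 0 0 d') =
  block_mx (wirtinger c a a') 0 0 (wirtinger c d d').
Proof.
by rewrite /wirtinger scale_block_mx add_block_mx scale_block_mx !scaler0 !addr0 !scaler0.
Qed.

Lemma mulii : 'i%C * 'i%C = -1 :> C.
Proof. by rewrite -expr2 sqr_i. Qed.

Lemma mconj_flow_xi K k : mconj (flow_xi K k) =
  mconj K ^+ k + (-1) ^+ k.+1 *: invmx (mconj K) ^+ k.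
Proof.
by rewrite /flow_xi mconjD mconjZ !mconjX mconj_inv rmorphXn rmorphN1.
Qed.

Lemma mconj_flow_eta K k : mconj (flow_eta K k) =
  'i%C *: ((-1) ^+ k.+1 *: invmx (mconj K) ^+ k - mconj K ^+ k).
Proof.
rewrite /flow_eta mconjZ mconjD mconjN mconjZ !mconjX mconj_inv rmorphXn rmorphN1.
by rewrite conjc_i scaleNr -scalerN opprB.
Qed.

Lemma bigZE K k :
  bigZ K k = block_mx (K ^+ k) 0 0 ((-1) ^+ k.+1 *: invmx (mconj K) ^+ k).
Proof.
have ii : - 'i%C * 'i%C = 1 :> C by rewrite mulNr mulii opprK.
rewrite /bigZ /bigB wirtinger_block mconj_flow_xi mconj_flow_eta.
apply: congr_block_mx => //; first exact: wirtinger_i.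
(* Conjugation changes the sign of [i], so in the lower block positive and negative powers exchange
   roles. *)
by rewrite [X in wirtinger _ X]addrC; exact: wirtinger_i.
Qed.

Lemma bigZbE K k :
  bigZb K k = block_mx ((-1) ^+ k.+1 *: invmx K ^+ k) 0 0 (mconj K ^+ k).
Proof.
rewrite /bigZb /bigB wirtinger_block mconj_flow_xi mconj_flow_eta.
apply: congr_block_mx => //; first exact: wirtinger_Ni mulii.
by rewrite [X in wirtinger _ X]addrC; exact: wirtinger_Ni mulii.
Qed.

(** The minus sign in the lower block of [bigK] absorbs the alternating sign of the flows. *)
Lemma bigZS K k : K \in unitmx -> bigZ K k.+1 *m invmx (bigK K) = bigZ K k.
Proof.
move=> uK; rewrite !bigZE (proj2 (bigKV uK)) mulmx_block.
rewrite !(mul0mx, mulmx0, addr0, add0r) !exprmxSr mulmxK // -scalemxAl mulmxN.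
by rewrite mulmxKV ?mconj_unit // scalerN exprS mulN1r scaleNr opprK.
Qed.

Lemma bigZbS K k : K \in unitmx -> bigZb K k *m invmx (bigK K) = - bigZb K k.+1.
Proof.
move=> uK; rewrite !bigZbE (proj2 (bigKV uK)) mulmx_block.
rewrite !(mul0mx, mulmx0, addr0, add0r) opp_block_mx !oppr0 !exprmxSr -scalemxAl mulmxN.
by rewrite [in RHS]exprS mulN1r scaleNr opprK.
Qed.

End Directions.

(** * Partial derivatives as derivatives along coordinate lines *)

Section Partial.
Variables (R : realType) (m n : nat) (k : nat) (F : mfun R m n) (x e : nat -> R).

Lemma upd_id (y : nat -> R) j : upd y j (y j) = y.
Proof. by apply/funext => i; rewrite /upd; case: eqP => [->|]. Qed.

Lemma is_derivmx_xi : derivable_xi k F x e ->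
  is_derivmx (fun u => F (upd x k u) e) (x k) (d_xi k F x e).
Proof. by move=> h i j; rewrite mxE; exact/derivableCP. Qed.

Lemma is_derivmx_eta : derivable_eta k F x e ->
  is_derivmx (fun u => F x (upd e k u)) (e k) (d_eta k F x e).
Proof. by move=> h i j; rewrite mxE; exact/derivableCP. Qed.

Lemma d_xiP D : is_derivmx (fun u => F (upd x k u) e) (x k) D ->
  derivable_xi k F x e /\ d_xi k F x e = D.
Proof.
move=> h; split; first by move=> i j; exact: is_derivC_derivable (h i j).
by apply/matrixP => i j; rewrite mxE (is_derivC_val (h i j)).
Qed.

Lemma d_etaP D : is_derivmx (fun u => F x (upd e k u)) (e k) D ->
  derivable_eta k F x e /\ d_eta k F x e = D.
Proof.
move=> h; split; first by move=> i j; exact: is_derivC_derivable (h i j).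
by apply/matrixP => i j; rewrite mxE (is_derivC_val (h i j)).
Qed.
End Partial.

(** * The Yang-Mills equation *)

Section SelfDualYangMills.
Variables (R : realType) (N : nat) (K : 'M[R[i]]_N).
Variables (r1 s1 : mfun R N 1) (M1 : mfun R N N).
Local Notation C := (R[i]).
Hypothesis uK : K \in unitmx.
Hypothesis disj : forall a, ~~ (eigenvalue K a && eigenvalue (- invmx (mconj K)) a).
Hypothesis syl : forall x e, K *m M1 x e + M1 x e *m invmx (mconj K)
  = - (r1 x e *m adjmx (s1 x e) *m invmx (mconj K)).
Hypothesis flow : forall (n : nat) x e, (0 < n)%N ->
  [/\ derivable_xi n r1 x e /\ d_xi n r1 x e = flow_xi K n *m r1 x e,
      derivable_eta n r1 x e /\ d_eta n r1 x e = flow_eta K n *m r1 x e,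
      derivable_xi n s1 x e /\ d_xi n s1 x e = (flow_xi K n)^T *m s1 x e &
      derivable_eta n s1 x e /\ d_eta n s1 x e = (flow_eta K n)^T *m s1 x e].

Let v : mfun R 2 2 := fun x e => vmat K (r1 x e) (s1 x e) (M1 x e).
Let dom x e := 1%:M - mconj (M1 x e) *m M1 x e \in unitmx.
Let W x e := bigW (M1 x e).
Let S x e := bigs K (s1 x e) *m W x e.
Let T x e := W x e *m bigr K (r1 x e).

(** Closed form of the derivative of [v], as [dcurrent] is for [current]. Both are complex-linear in
    [B], so the complex directions [bigZ] and [bigZb] may be inserted although they belong to no
    real line. *)
Definition dvmat (B : 'M[C]_(N + N)) : mfun R 2 2 := fun x e =>
  let A := S x e *m B *m W x e *m invmx (bigK K) *m bigr K (r1 x e) in - (A + A).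
Definition current (X : 'M[C]_(N + N)) : mfun R 2 2 := fun x e =>
  S x e *m X *m T x e.
Definition dcurrent (X B : 'M[C]_(N + N)) : mfun R 2 2 := fun x e =>
  let Q := W x e + W x e - 1%:M in S x e *m (B *m Q *m X + X *m Q *m B) *m T x e.

Lemma line_xi n x e : (0 < n)%N -> dom x e ->
  [/\ \forall u \near x n, dom (upd x n u) e,
      is_derivmx (fun u => v (upd x n u) e) (x n) (dvmat (bigB (flow_xi K n)) x e) &
      forall X, is_derivmx (fun u => current X (upd x n u) e) (x n)
        (dcurrent X (bigB (flow_xi K n)) x e)].
Proof.
move=> n0 dxe; have [[dr er] _ [ds es] _] := flow x e n0.
have /is_derivmx_xi hr := dr; have /is_derivmx_xi hs := ds.
have xE := upd_id x n.
(* The base point is written as the value of the line at its own parameter, the form used in the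
   flow lemmas. *)
rewrite er -[X in r1 X]xE in hr; rewrite es -[X in s1 X]xE in hs.
have cK := flow_xi_commute n uK.
have dxe' : dom (upd x n (x n)) e by rewrite xE.
have sy u := syl (upd x n u) e.
split.
- exact: (dom_near uK disj sy cK hr hs dxe').
- have := is_derivmx_vmat uK disj sy cK hr hs dxe'.
  by rewrite xE.
- move=> X; have := is_derivmx_current uK disj sy cK hr hs dxe' X.
  by rewrite xE.
Qed.

Lemma line_eta n x e : (0 < n)%N -> dom x e ->
  [/\ \forall u \near e n, dom x (upd e n u),
      is_derivmx (fun u => v x (upd e n u)) (e n) (dvmat (bigB (flow_eta K n)) x e) &
      forall X, is_derivmx (fun u => current X x (upd e n u)) (e n)
        (dcurrent X (bigB (flow_eta K n)) x e)].
Proof.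
move=> n0 dxe; have [_ [dr er] _ [ds es]] := flow x e n0.
have /is_derivmx_eta hr := dr; have /is_derivmx_eta hs := ds.
have eE := upd_id e n.
rewrite er -[X in r1 _ X]eE in hr; rewrite es -[X in s1 _ X]eE in hs.
have cK := flow_eta_commute n uK.
have dxe' : dom x (upd e n (e n)) by rewrite eE.
have sy u := syl x (upd e n u).
split.
- exact: (dom_near uK disj sy cK hr hs dxe').
- have := is_derivmx_vmat uK disj sy cK hr hs dxe'.
  by rewrite eE.
- move=> X; have := is_derivmx_current uK disj sy cK hr hs dxe' X.
  by rewrite eE.
Qed.

Lemma dvmat_wirtinger c B B' x e :
  wirtinger c (dvmat B x e) (dvmat B' x e) = dvmat (wirtinger c B B') x e.
Proof. by rewrite /dvmat wirtingerN wirtingerD !wirtingerMr wirtingerMl. Qed.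

Lemma dcurrent_wirtinger c X B B' x e :
  wirtinger c (dcurrent X B x e) (dcurrent X B' x e) =
  dcurrent X (wirtinger c B B') x e.
Proof.
by rewrite /dcurrent wirtingerMr wirtingerMl wirtingerD !wirtingerMr wirtingerMl.
Qed.

Lemma d_zE m n k (F : mfun R m n) x e :
  d_z k F x e = wirtinger (- 'i%C) (d_xi k F x e) (d_eta k F x e).
Proof. by rewrite /wirtinger scaleNr. Qed.

Lemma d_z_vmat n x e : (0 < n)%N -> dom x e -> d_z n v x e = dvmat (bigZ K n) x e.
Proof.
move=> n0 dxe; have [_ /d_xiP[_ h1] _] := line_xi n0 dxe.
have [_ /d_etaP[_ h2] _] := line_eta n0 dxe.
by rewrite d_zE h1 h2; exact: dvmat_wirtinger.
Qed.

Lemma d_zbar_vmat n x e : (0 < n)%N -> dom x e -> d_zbar n v x e = dvmat (bigZb K n) x e.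
Proof.
move=> n0 dxe; have [_ /d_xiP[_ h1] _] := line_xi n0 dxe.
have [_ /d_etaP[_ h2] _] := line_eta n0 dxe.
by rewrite -[LHS]/(wirtinger 'i%C _ _) h1 h2; exact: dvmat_wirtinger.
Qed.

(** By [resolvent_dressing], [W K^-1 r v^-1 = K^-1 W r], so the logarithmic derivative of [v]
    becomes a current. *)
Lemma dvmat_inv B x e : dom x e ->
  dvmat B x e *m invmx (v x e) =
  current (- (B *m invmx (bigK K) + B *m invmx (bigK K))) x e.
Proof.
move=> dxe.
have vV : invmx (v x e) = bigvV K (r1 x e) (s1 x e) (M1 x e).
  rewrite /v (vmat_bigv uK dxe (syl x e)).
  exact: (proj2 (invmx_right (bigvK uK dxe (syl x e)))).
have E : W x e *m invmx (bigK K) *m bigr K (r1 x e) *m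
    bigvV K (r1 x e) (s1 x e) (M1 x e) = invmx (bigK K) *m T x e.
  rewrite /T mulmxA; exact: (resolvent_dressing (proj1 (bigKV uK))
    (proj1 (bigWE dxe)) (bigK_sylvester uK (syl x e))).
rewrite vV /dvmat /current mulNmx mulmxDl.
have -> : S x e *m B *m W x e *m invmx (bigK K) *m bigr K (r1 x e) *m
    bigvV K (r1 x e) (s1 x e) (M1 x e) =
  S x e *m (B *m invmx (bigK K)) *m T x e.
  rewrite -!(mulmxA (S x e)); congr (_ *m _).
  rewrite -!(mulmxA B); congr (_ *m _).
  by rewrite -E.
by rewrite mulmxN mulNmx mulmxDr mulmxDl.
Qed.

(** Agreement is required on the domain only, since [dvmat_inv] holds there; each coordinate line
    stays in it near the point. *)
Lemma d_current k (F : mfun R 2 2) X x e : (0 < k)%N -> dom x e ->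
  (forall x' e', dom x' e' -> F x' e' = current X x' e') ->
  [/\ derivable_xi k F x e, derivable_eta k F x e,
      d_z k F x e = dcurrent X (bigZ K k) x e &
      d_zbar k F x e = dcurrent X (bigZb K k) x e].
Proof.
move=> k0 dxe FX.
have [nx _ /(_ X) hx] := line_xi k0 dxe; have [ne _ /(_ X) he] := line_eta k0 dxe.
have {}hx : is_derivmx (fun u => F (upd x k u) e) (x k)
    (dcurrent X (bigB (flow_xi K k)) x e).
  by apply: near_eq_is_derivmx hx; apply: filterS nx => u /FX ->.
have {}he : is_derivmx (fun u => F x (upd e k u)) (e k)
    (dcurrent X (bigB (flow_eta K k)) x e).
  by apply: near_eq_is_derivmx he; apply: filterS ne => u /FX ->.
have [h1 h2] := d_xiP hx; have [h3 h4] := d_etaP he.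
split; [exact: h1 | exact: h3 | |].
- by rewrite d_zE h2 h4; exact: dcurrent_wirtinger.
- by rewrite -[LHS]/(wirtinger 'i%C _ _) h2 h4; exact: dcurrent_wirtinger.
Qed.

Lemma dcurrentC X B x e : dcurrent X B x e = dcurrent B X x e.
Proof. by rewrite /dcurrent addrC. Qed.

Lemma dcurrentN X B x e : dcurrent (- X) B x e = - dcurrent X B x e.
Proof.
rewrite /dcurrent; move: (W x e + W x e - 1%:M) (S x e) (T x e) => Q A A'.
by rewrite mulmxN !mulNmx -opprD mulmxN mulNmx.
Qed.

Lemma dcurrentD X Y B x e :
  dcurrent (X + Y) B x e = dcurrent X B x e + dcurrent Y B x e.
Proof.
rewrite /dcurrent; move: (W x e + W x e - 1%:M) (S x e) (T x e) => Q A A'.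
have -> : B *m Q *m (X + Y) + (X + Y) *m Q *m B =
    (B *m Q *m X + X *m Q *m B) + (B *m Q *m Y + Y *m Q *m B).
  by rewrite mulmxDr !mulmxDl addrACA.
move: (B *m Q *m X + _) (B *m Q *m Y + _) => D E.
by rewrite mulmxDr mulmxDl.
Qed.

Lemma yang_mills n x e : (0 < n)%N -> dom x e ->
  [/\ derivable_xi n v x e /\ derivable_eta n v x e,
      derivable_xi n.+1 (fun x e => d_z n.+1 v x e *m invmx (v x e)) x e,
      derivable_eta n.+1 (fun x e => d_z n.+1 v x e *m invmx (v x e)) x e /\
      derivable_xi n (fun x e => d_zbar n v x e *m invmx (v x e)) x e,
      derivable_eta n (fun x e => d_zbar n v x e *m invmx (v x e)) x e &
      d_zbar n.+1 (fun x e => d_z n.+1 v x e *m invmx (v x e)) x e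
      + d_z n (fun x e => d_zbar n v x e *m invmx (v x e)) x e = 0].
Proof.
move=> n0 dxe.
(* The factor [K^-1] from [dvmat_inv] lowers [n.+1] to [n] in the first current and raises [n] to
   [n.+1] in the second, so each current is then differentiated along the direction occurring in the
   other. *)
have h1 x' e' : dom x' e' -> d_z n.+1 v x' e' *m invmx (v x' e') =
    current (- (bigZ K n + bigZ K n)) x' e'.
  by move=> d'; rewrite d_z_vmat // dvmat_inv // bigZS.
have h2 x' e' : dom x' e' -> d_zbar n v x' e' *m invmx (v x' e') =
    current (bigZb K n.+1 + bigZb K n.+1) x' e'.
  by move=> d'; rewrite d_zbar_vmat // dvmat_inv // bigZbS // -opprD opprK.
have [a1 a2 _ a4] := d_current (ltn0Sn n) dxe h1.
have [b1 b2 b3 _] := d_current n0 dxe h2.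
have [_ /d_xiP[c1 _] _] := line_xi n0 dxe.
have [_ /d_etaP[c2 _] _] := line_eta n0 dxe.
split; [by [] | exact: a1 | by [] | exact: b2 |].
apply: etrans (congr2 +%R a4 b3) _.
have E1 : dcurrent (- (bigZ K n + bigZ K n)) (bigZb K n.+1) x e =
    - (dcurrent (bigZb K n.+1) (bigZ K n) x e + dcurrent (bigZb K n.+1) (bigZ K n) x e).
  apply: etrans (dcurrentN _ _ _ _) _; congr (- _).
  apply: etrans (dcurrentD _ _ _ _ _) _.
  by apply: congr2; exact: dcurrentC.
have E2 := dcurrentD (bigZb K n.+1) (bigZb K n.+1) (bigZ K n) x e.
apply: etrans (congr2 +%R E1 E2) _.
exact: addNr.
Qed.
End SelfDualYangMills.

Theorem theorem3 (R : realType) (N : nat) (hN : (0 < N)%N)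
  (K1 : 'M[R[i]]_N)
  (r1 s1 : mfun R N 1) (M1 : mfun R N N) :
  K1 \in unitmx ->
  (forall a : R[i], ~~ (eigenvalue K1 a && eigenvalue (- invmx (mconj K1)) a)) ->
  (forall xi eta,
     K1 *m M1 xi eta + M1 xi eta *m invmx (mconj K1)
     = - (r1 xi eta *m adjmx (s1 xi eta) *m invmx (mconj K1))) ->
  (forall (n : nat) xi eta, (0 < n)%N ->
     [/\ derivable_xi n r1 xi eta /\
         d_xi n r1 xi eta = (K1 ^+ n + (-1) ^+ n.+1 *: invmx K1 ^+ n) *m r1 xi eta,
         derivable_eta n r1 xi eta /\
         d_eta n r1 xi eta
           = 'i%C *: ((K1 ^+ n - (-1) ^+ n.+1 *: invmx K1 ^+ n) *m r1 xi eta),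
         derivable_xi n s1 xi eta /\
         d_xi n s1 xi eta
           = (K1^T ^+ n + (-1) ^+ n.+1 *: invmx K1^T ^+ n) *m s1 xi eta &
         derivable_eta n s1 xi eta /\
         d_eta n s1 xi eta
           = 'i%C *: ((K1^T ^+ n - (-1) ^+ n.+1 *: invmx K1^T ^+ n) *m s1 xi eta)]) ->
  let v : mfun R 2 2 := fun xi eta => vmat K1 (r1 xi eta) (s1 xi eta) (M1 xi eta) in
  let dom xi eta := (1%:M - mconj (M1 xi eta) *m M1 xi eta) \in unitmx in
  forall xi eta, dom xi eta ->
  [/\ (* v is differentiable in every variable, and the Yang--Mills equation holds *)
      (forall n : nat, (0 < n)%N ->
         [/\ derivable_xi n v xi eta /\ derivable_eta n v xi eta,
             derivable_xi n.+1 (fun x e => d_z n.+1 v x e *m invmx (v x e)) xi eta,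
             derivable_eta n.+1 (fun x e => d_z n.+1 v x e *m invmx (v x e)) xi eta /\
             derivable_xi n (fun x e => d_zbar n v x e *m invmx (v x e)) xi eta,
             derivable_eta n (fun x e => d_zbar n v x e *m invmx (v x e)) xi eta &
             d_zbar n.+1 (fun x e => d_z n.+1 v x e *m invmx (v x e)) xi eta
             + d_z n (fun x e => d_zbar n v x e *m invmx (v x e)) xi eta = 0]),
      adjmx (v xi eta) = v xi eta,
      \det (v xi eta) = 1 &
      posdef (v xi eta) \/ negdef (v xi eta)].
Proof.
move=> uK disj syl flow v dom xi eta dxe.
(* The hypotheses are put in flow form, with the scalar [i] inside the matrix and the flows of [s1]
   as transposes of those of [r1]. *)
have flow' n x e : (0 < n)%N ->
  [/\ derivable_xi n r1 x e /\ d_xi n r1 x e = flow_xi K1 n *m r1 x e,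
      derivable_eta n r1 x e /\ d_eta n r1 x e = flow_eta K1 n *m r1 x e,
      derivable_xi n s1 x e /\ d_xi n s1 x e = (flow_xi K1 n)^T *m s1 x e &
      derivable_eta n s1 x e /\ d_eta n s1 x e = (flow_eta K1 n)^T *m s1 x e].
  move=> n0; have [h1 [h2 e2] h3 [h4 e4]] := flow n x e n0.
  rewrite flow_xi_tr flow_eta_tr; split=> //; split=> //.
  - by rewrite e2 /flow_eta scalemxAl.
  - by rewrite e4 scalemxAl.
have vE : v xi eta = bigv K1 (r1 xi eta) (s1 xi eta) (M1 xi eta).
  exact: vmat_bigv uK dxe (syl xi eta).
have vH : adjmx (v xi eta) = v xi eta.
  by rewrite vE; exact: bigv_hermitian uK dxe (syl xi eta).
have v1 : \det (v xi eta) = 1 by rewrite vE; exact: bigv_det uK dxe (syl xi eta).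
split=> //; last exact: hermitian_det1_definite.
by move=> n n0; exact: (yang_mills uK disj syl flow' n0 dxe).
Qed.
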